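(* Let $d\geq 2$, $1\leq k\leq d-1$, let $A\subset\mathbb{R}^d$ have positive reach and let $a\in T_k(A)$. Then there exists $\delta>0$ such that the mapping $\psi_k^A$ is Lipschitz on $T_k(A)\cap B(a,\delta)$ (with respect to the metric $\rho_k$ on $G(d,k)$).
   Context: A set $A\subset\mathbb{R}^d$ has positive reach if there is $\varepsilon>0$ such that every $x$ with $\mathrm{dist}(x,A)<\varepsilon$ has a unique nearest point in $A$. $\operatorname{Tan}(A,x)$ is the tangent cone of $A$ at $x\in A$ ($u\in\operatorname{Tan}(A,x)$ iff $u=0$ or $r_i(x_i-x)\to u$ for some $x\neq x_i\in A$, $x_i\to x$, $r_i>0$); $\widetilde{\operatorname{Tan}}(A,x)=\operatorname{span}\operatorname{Tan}(A,x)$. $T_k(A)=\{x\in A:\dim\widetilde{\operatorname{Tan}}(A,x)=k\}$. $G(d,k)$ is the Grassmannian of $k$-dimensional linear subspaces of $\mathbb{R}^d$, with the metric $\rho_k(U,V)=\max\big(\sup_{u\in U,|u|=1}\mathrm{dist}(u,V),\sup_{v\in V,|v|=1}\mathrm{dist}(v,U)\big)$ (equivalently $\|\pi_U-\pi_V\|$ for orthogonal projections). $\psi_k^A:T_k(A)\to G(d,k)$ is $\psi_k^A(x)=\widetilde{\operatorname{Tan}}(A,x)$. *)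

(* Defs.v *)
From HB Require Import structures.
From mathcomp Require Import all_boot all_order all_algebra.
From mathcomp Require Import all_classical all_reals all_analysis.
Set Implicit Arguments. Unset Strict Implicit. Unset Printing Implicit Defensive.
Import Order.TTheory GRing.Theory Num.Theory.
Import numFieldNormedType.Exports.
Local Open Scope classical_set_scope.
Local Open Scope ring_scope.

Section Defs.
Variables (R : realType) (d : nat).
Notation vec := 'rV[R]_d.

Definition edot (u v : vec) : R := \sum_(i < d) u 0 i * v 0 i.
Definition enorm (u : vec) : R := Num.sqrt (edot u u).

Definition edist (x : vec) (A : set vec) : R :=
  inf [set enorm (x - a) | a in A].

Definition unique_nearest (A : set vec) (x : vec) : Prop :=
  exists! p : vec, A p /\ forall q, A q -> enorm (x - p) <= enorm (x - q).

Definition positive_reach (A : set vec) : Prop :=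
  exists eps : R, 0 < eps /\
    forall x : vec, edist x A < eps -> unique_nearest A x.

Definition Tan (A : set vec) (x : vec) : set vec :=
  [set u | u = 0 \/
    exists (xs : nat -> vec) (r : nat -> R),
      (forall i, A (xs i) /\ xs i != x /\ 0 < r i) /\
      ((fun i => enorm (xs i - x)) @ \oo --> (0 : R)) /\
      ((fun i => enorm (r i *: (xs i - x) - u)) @ \oo --> (0 : R))].

Definition span (S : set vec) : set vec :=
  [set v | exists (n : nat) (c : 'I_n -> R) (vs : 'I_n -> vec),
      (forall i, S (vs i)) /\ v = \sum_(i < n) c i *: vs i].

Definition Tant (A : set vec) (x : vec) : set vec := span (Tan A x).

(* V is a linear subspace of R^d of dimension k, i.e. V has a basis of
   k vectors (the rows of a rank-k k x d matrix). *)
Definition subspace_dim (V : set vec) (k : nat) : Prop :=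
  exists M : 'M[R]_(k, d), \rank M = k /\ forall v : vec, V v <-> (v <= M)%MS.

Definition T_k (A : set vec) (k : nat) : set vec :=
  [set x | A x /\ subspace_dim (Tant A x) k].

Definition rho (U V : set vec) : R :=
  Num.max (sup [set edist u V | u in [set u | U u /\ enorm u = 1]])
          (sup [set edist v U | v in [set v | V v /\ enorm v = 1]]).

Definition psi_lipschitz_on (A : set vec) (E : set vec) : Prop :=
  exists L : R, forall x y, E x -> E y ->
    rho (Tant A x) (Tant A y) <= L * enorm (x - y).

Definition eball (a : vec) (delta : R) : set vec :=
  [set x | enorm (x - a) < delta].
End Defs.

(* Main.v *)
Require Import Defs.
From HB Require Import structures.
From mathcomp Require Import all_boot all_order all_algebra.
From mathcomp Require Import all_classical all_reals all_analysis.
From mathcomp Require Import ring lra.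
Set Implicit Arguments.
Unset Strict Implicit.
Unset Printing Implicit Defensive.
Import Order.TTheory GRing.Theory Num.Theory.
Import numFieldNormedType.Exports.
Local Open Scope classical_set_scope.
Local Open Scope ring_scope.

(* Near [A] the distance function grows at unit rate away from the unique
   nearest point.  Maximising it over small balls shows that normal rays extend:
   if [z] is nearest to [p], it is nearest to every point of the ray from [z]
   through [p] at distance [r < eps].  The resulting empty balls give
   [2 r <p - z, b - z> <= |p - z| |b - z|^2] for [b] in [A].  Applied at both
   endpoints of a segment [[x, b]] this bounds the distance from
   [x + l (b - x)] to [A] by [l |b - x|^2 / eps], and letting [l] tend to [0]
   yields [dist (b - x, Tan A x) <= |b - x|^2 / eps].

   Take a basis [u_i] of [Tant A a] in [Tan A a].  For [x], [y] in [A] near [a]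
   and [s = |x - y|], there are points [z_i] of [A] close to [x + s u_i].  The
   chords [z_i - x], [z_i - y] and [x - y] are within [O(s^2)] of the tangent
   cones at [x] and [y], so that, after division by [s], [Tant A x] and
   [Tant A y] contain vectors which are close to [u_i] and within [O(s)] of each
   other.  When both spaces have the dimension of [Tant A a], these vectors are
   bases. *)

(* Both names are shadowed by the libraries. *)
Local Notation edist := Defs.edist.
Local Notation span := Defs.span.

Section MatrixNorm.
Context {R : realType}.
Implicit Types (m n p : nat).

Lemma mx_norm_le m n (A : 'M[R]_(m, n)) c : 0 <= c ->
  (forall i j, `|A i j| <= c) -> `|A| <= c.
Proof.
move=> c0 Ac; rewrite -[leLHS]/(mx_norm A) mx_normrE.
by apply/bigmax_leP; split=> // -[i j] _; exact: Ac.
Qed.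

Lemma le_mx_norm m n (A : 'M[R]_(m, n)) i j : `|A i j| <= `|A|.
Proof.
rewrite -[leRHS]/(mx_norm A) mx_normrE; apply/bigmax_geP; right.
by exists (i, j).
Qed.

Lemma mx_norm_row m n (A : 'M[R]_(m, n)) i : `|row i A| <= `|A|.
Proof. by apply: mx_norm_le => // ? j; rewrite mxE le_mx_norm. Qed.

Lemma mx_normM m n p (A : 'M[R]_(m, n)) (B : 'M[R]_(n, p)) :
  `|A *m B| <= n%:R * `|A| * `|B|.
Proof.
apply: mx_norm_le => [|i j]; first by rewrite !mulr_ge0.
rewrite mxE (le_trans (ler_norm_sum _ _ _))// -mulrA.
apply: le_trans (_ : \sum_(k < n) `|A| * `|B| <= _).
  by apply: ler_sum => k _; rewrite normrM ler_pM ?le_mx_norm.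
by rewrite sumr_const card_ord mulr_natl.
Qed.

Lemma row_free_near_inj_bound k d (M : 'M[R]_(k, d)) : row_free M ->
  exists2 K, 0 <= K & exists2 e, 0 < e &
    forall P : 'M[R]_(k, d), `|P - M| <= e ->
    forall c : 'rV_k, `|c| <= K * `|c *m P|.
Proof.
move=> /row_freeP[B MB]; pose b := d%:R * `|B| + 1.
have b0 : 0 < b by rewrite ltr_wpDl ?mulr_ge0.
pose e := (2 * b * (k%:R + 1))^-1.
exists (2 * b); first by rewrite mulr_ge0// ltW.
exists e => [|P PM c]; first by rewrite invr_gt0 !mulr_gt0// ltr_wpDl.
have cM : `|c| <= b * `|c *m M|.
  rewrite -[c in leLHS]mulmx1 -MB mulmxA (le_trans (mx_normM _ _))//.
  by rewrite mulrAC ler_wpM2r// lerDl.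
have cPM : `|c *m M| <= `|c *m P| + k%:R * `|c| * e.
  rewrite -[M in leLHS](subKr P) mulmxBr (le_trans (ler_normB _ _))// lerD2l.
  by rewrite (le_trans (mx_normM _ _))// ler_wpM2l ?mulr_ge0.
have be : 2 * b * (k%:R * `|c| * e) <= `|c|.
  have -> : 2 * b * (k%:R * `|c| * e) = k%:R / (k%:R + 1) * `|c|.
    by rewrite /e; field; rewrite !gt_eqF ?ltr_wpDl.
  by rewrite ler_piMl// ler_pdivrMr ?ltr_wpDl// mul1r lerDl.
by have := ler_wpM2l (ltW b0) cPM; lra.
Qed.

End MatrixNorm.

Lemma nbhs_right0_mulr_le {R : realType} (c t : R) : 0 < c -> 0 < t ->
  \forall x \near 0^'+, x * c <= t.
Proof.
move=> c0 t0; near=> x; rewrite -ler_pdivlMr//.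
by near: x; apply: nbhs_right_le; rewrite divr_gt0.
Unshelve. all: by end_near. Qed.

Section EuclideanNorm.
Context {R : realType} {d : nat}.
Implicit Types (u v w x y z : 'rV[R]_d) (c r : R).

Lemma edotC u v : edot u v = edot v u.
Proof. by apply: eq_bigr => i _; rewrite mulrC. Qed.

Lemma edotDl u v w : edot (u + v) w = edot u w + edot v w.
Proof. by rewrite -big_split; apply: eq_bigr => i _; rewrite mxE mulrDl. Qed.

Lemma edotZl c u v : edot (c *: u) v = c * edot u v.
Proof. by rewrite mulr_sumr; apply: eq_bigr => i _; rewrite mxE mulrA. Qed.

Lemma edotNl u v : edot (- u) v = - edot u v.
Proof. by rewrite -scaleN1r edotZl mulN1r. Qed.

Lemma edotDr u v w : edot w (u + v) = edot w u + edot w v.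
Proof. by rewrite edotC edotDl !(edotC w). Qed.

Lemma edotZr c u v : edot u (c *: v) = c * edot u v.
Proof. by rewrite edotC edotZl edotC. Qed.

Lemma edotNr u v : edot u (- v) = - edot u v.
Proof. by rewrite edotC edotNl edotC. Qed.

Lemma edot0l v : edot 0 v = 0.
Proof. by rewrite -(scale0r 0) edotZl mul0r. Qed.

Lemma edot0r u : edot u 0 = 0.
Proof. by rewrite edotC edot0l. Qed.

Lemma edot_ge0 u : 0 <= edot u u.
Proof. by apply: sumr_ge0 => i _; rewrite -expr2 sqr_ge0. Qed.

Lemma enorm_ge0 u : 0 <= enorm u.
Proof. exact: sqrtr_ge0. Qed.

Lemma enorm_sqr u : enorm u ^+ 2 = edot u u.
Proof. by rewrite sqr_sqrtr // edot_ge0. Qed.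

Lemma ler_enorm_sqr u c : 0 <= c -> (enorm u <= c) = (enorm u ^+ 2 <= c ^+ 2).
Proof. by move=> c0; rewrite ler_sqr ?nnegrE ?enorm_ge0. Qed.

Lemma enormZ c u : enorm (c *: u) = `|c| * enorm u.
Proof.
by rewrite /enorm edotZl edotZr mulrA -expr2 sqrtrM ?sqr_ge0// sqrtr_sqr.
Qed.

Lemma enorm0 : enorm (0 : 'rV[R]_d) = 0.
Proof. by rewrite -(scale0r 0) enormZ normr0 mul0r. Qed.

Lemma enormN u : enorm (- u) = enorm u.
Proof. by rewrite -scaleN1r enormZ normrN1 mul1r. Qed.

Lemma enorm_distC u v : enorm (u - v) = enorm (v - u).
Proof. by rewrite -enormN opprB. Qed.

Lemma enorm_invZB c u v : 0 < c ->
  enorm (c^-1 *: u - v) = enorm (u - c *: v) / c.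
Proof.
move=> c0; rewrite -[v in LHS](scalerK (lt0r_neq0 c0)) -scalerBr enormZ.
by rewrite ger0_norm ?invr_ge0 ?(ltW c0)// mulrC.
Qed.

Lemma norm_le_enorm u : `|u| <= enorm u.
Proof.
apply: mx_norm_le => [|i j]; first exact: enorm_ge0.
rewrite ord1 -sqrtr_sqr ler_sqrt ?edot_ge0// /edot (bigD1 j)//= -expr2 lerDl.
by apply: sumr_ge0 => l _; rewrite -expr2 sqr_ge0.
Qed.

Lemma enorm_eq0 u : enorm u = 0 -> u = 0.
Proof. by move=> u0; apply/eqP; rewrite -normr_le0 -u0 norm_le_enorm. Qed.

Lemma enorm_gt0 u : u != 0 -> 0 < enorm u.
Proof.
move=> u0; rewrite lt_def enorm_ge0 andbT.
by apply: contra_neq u0 => /enorm_eq0.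
Qed.

Lemma enorm_sqrD u v :
  enorm (u + v) ^+ 2 = enorm u ^+ 2 + 2 * edot u v + enorm v ^+ 2.
Proof. by rewrite !enorm_sqr edotDl !edotDr (edotC v u); ring. Qed.

Lemma enorm_sqrB u v :
  enorm (u - v) ^+ 2 = enorm u ^+ 2 - 2 * edot u v + enorm v ^+ 2.
Proof. by rewrite enorm_sqrD enormN edotNr mulrN. Qed.

Lemma enorm_sqr_scaleB u v :
  enorm (enorm v *: u - enorm u *: v) ^+ 2 =
  2 * (enorm u * enorm v) * (enorm u * enorm v - edot u v).
Proof.
by rewrite enorm_sqrB !enormZ edotZl edotZr !ger0_norm ?enorm_ge0//; ring.
Qed.

Lemma edot_le_enorm u v : edot u v <= enorm u * enorm v.
Proof.
have [->|u0] := eqVneq u 0; first by rewrite edot0l enorm0 mul0r.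
have [->|v0] := eqVneq v 0; first by rewrite edot0r enorm0 mulr0.
have uv0 : 0 < enorm u * enorm v by rewrite mulr_gt0 ?enorm_gt0.
have := sqr_ge0 (enorm (enorm v *: u - enorm u *: v)).
by rewrite enorm_sqr_scaleB -mulrA pmulr_rge0// pmulr_rge0// subr_ge0.
Qed.

Lemma enormD u v : enorm (u + v) <= enorm u + enorm v.
Proof.
rewrite ler_enorm_sqr ?addr_ge0 ?enorm_ge0// enorm_sqrD.
by have := edot_le_enorm u v; nra.
Qed.

Lemma enorm_distD v u w : enorm (u - w) <= enorm (u - v) + enorm (v - w).
Proof. by have := enormD (u - v) (v - w); rewrite addrA subrK. Qed.

Lemma enormD_eq_colinear u v :
  enorm (u + v) = enorm u + enorm v -> enorm v *: u = enorm u *: v.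
Proof.
move=> /(congr1 (fun c => c ^+ 2)); rewrite enorm_sqrD => uv.
apply/eqP; rewrite -subr_eq0; apply/eqP/enorm_eq0/eqP.
rewrite -sqrf_eq0 enorm_sqr_scaleB; apply/eqP.
have -> : edot u v = enorm u * enorm v.
  by move: uv; rewrite sqrrD -mulr_natl; lra.
by rewrite subrr mulr0.
Qed.

Lemma enorm_le_norm u : enorm u <= d%:R * `|u|.
Proof.
rewrite ler_enorm_sqr ?mulr_ge0// enorm_sqr.
apply: le_trans (_ : \sum_(i < d) `|u| ^+ 2 <= _).
  apply: ler_sum => i _; rewrite -expr2 -real_normK ?num_real//.
  by rewrite ler_sqr ?nnegrE ?le_mx_norm.
rewrite sumr_const card_ord -[leLHS]mulr_natl exprMn ler_wpM2r ?sqr_ge0//.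
by rewrite -natrX ler_nat; case: (d) => // n; rewrite leq_pmulr.
Qed.

Lemma enorm_lipschitz_continuous (f : 'rV[R]_d -> R) c :
  (forall x y, f x - f y <= c * enorm (x - y)) -> continuous f.
Proof.
move=> fc x; apply/(@cvgrPdist_le _ R _ (nbhs x)) => e e0.
pose K := `|c| * d%:R + 1.
have K0 : 0 < K by rewrite ltr_wpDl ?mulr_ge0.
near=> y.
have cxy : c * enorm (x - y) <= e.
  have xy : `|x - y| <= e / K.
    by near: y; apply: cvgr_dist_le => //; rewrite divr_gt0.
  rewrite ler_pdivlMr// mulrC in xy; apply: le_trans xy.
  apply: (@le_trans _ _ (`|c| * (d%:R * `|x - y|))); last first.
    by rewrite mulrA ler_wpM2r// lerDl.
  apply: le_trans (ler_wpM2l (normr_ge0 c) (enorm_le_norm _)).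
  by rewrite ler_wpM2r ?enorm_ge0 ?ler_norm.
by have := fc x y; have := fc y x; rewrite (enorm_distC y) ler_norml; lra.
Unshelve. all: by end_near. Qed.

Lemma enorm_dist_continuous x : continuous (fun y => enorm (y - x)).
Proof.
apply: (@enorm_lipschitz_continuous _ 1) => y z.
by rewrite mul1r lerBlDr enorm_distD.
Qed.

Definition closed_eball x r : set 'rV[R]_d := [set y | enorm (y - x) <= r].

Lemma closed_eball_compact x r : compact (closed_eball x r).
Proof.
apply: bounded_closed_compact; last first.
  apply: preimage_closed (@closed_le _ r) => y _.
  exact: enorm_dist_continuous.
exists (enorm x + r); split; first exact: num_real.
move=> M xrM y; rewrite /closed_eball/= => yr.
apply: le_trans (norm_le_enorm y) _.
by have := enorm_distD x y 0; rewrite !subr0; lra.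
Qed.

Lemma closed_eball_max (f : 'rV[R]_d -> R) x r : continuous f -> 0 <= r ->
  exists2 y, closed_eball x r y & forall z, closed_eball x r z -> f z <= f y.
Proof.
move=> cf r0; have x_ball : closed_eball x r !=set0.
  by exists x; rewrite /closed_eball/= subrr enorm0.
have [y] :=
  EVT_max_rV x_ball (@closed_eball_compact x r) (continuous_subspaceT cf).
by rewrite inE => yB ymax; exists y => // z zB; rewrite ymax ?inE.
Qed.

End EuclideanNorm.

Section Distance.
Context {R : realType} {d : nat}.
Variable A : set 'rV[R]_d.
Implicit Types (b q x y z : 'rV[R]_d) (c e : R).

Lemma edist_le x b : A b -> edist x A <= enorm (x - b).
Proof.
move=> Ab; apply: ge_inf; last by exists b.
by exists 0 => _ [c _ <-]; exact: enorm_ge0.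
Qed.

Lemma le_edist x c : A !=set0 ->
  (forall b, A b -> c <= enorm (x - b)) -> c <= edist x A.
Proof.
move=> [a Aa] cA; apply: lb_le_inf; first by exists (enorm (x - a)), a.
by move=> _ [b Ab <-]; exact: cA.
Qed.

Lemma edist_lipschitz x y : edist x A - edist y A <= enorm (x - y).
Proof.
have [/eqP A0|/set0P A0] := boolP (A == set0).
  by rewrite /edist A0 !image_set0 subrr enorm_ge0.
rewrite lerBlDr -lerBlDl; apply: le_edist => // b Ab; rewrite lerBlDl.
exact: le_trans (edist_le x Ab) (enorm_distD _ _ _).
Qed.

Lemma edist_set_continuous : continuous (fun x => edist x A).
Proof.
apply: (@enorm_lipschitz_continuous _ _ _ 1) => x y.
by rewrite mul1r edist_lipschitz.
Qed.

Definition nearest x z : Prop :=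
  A z /\ forall b, A b -> enorm (x - z) <= enorm (x - b).

Lemma edist_nearest x z : nearest x z -> edist x A = enorm (x - z).
Proof.
move=> [Az zmin]; apply/le_anti; rewrite edist_le//=.
by apply: le_edist => //; exists z.
Qed.

Lemma nearest_stable q z e : closed A -> unique (nearest q) z -> 0 < e ->
  exists2 h, 0 < h &
    forall b, A b -> enorm (q - b) <= enorm (q - z) + h -> enorm (b - z) < e.
Proof.
move=> clA [[Az zmin] zuniq] e0; set D := enorm (q - z).
pose K := closed_eball q (D + 1) `&` (A `&` [set b | e <= enorm (b - z)]).
have cK : compact K.
  apply: compact_closedI; [exact: closed_eball_compact|apply: closedI => //].
  apply: preimage_closed (@closed_ge _ e) => b _.
  exact: enorm_dist_continuous.
have notK h b : h <= 1 -> A b -> enorm (q - b) <= D + h -> ~ K b ->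
    enorm (b - z) < e.
  move=> h1 Ab qb; apply: contra_notT; rewrite -leNgt => be.
  by split=> //; rewrite /closed_eball/= enorm_distC (le_trans qb)// lerD2l.
have [K0|K0] := pselect (K !=set0); last first.
  by exists 1 => // b Ab qb; apply: notK qb _ => // Kb; apply: K0; exists b.
have [c] :=
  EVT_min_rV K0 cK (continuous_subspaceT (@enorm_dist_continuous _ _ q)).
rewrite inE => -[_ [Ac ce]] cmin.
have Dc : D < enorm (q - c).
  rewrite ltNge; apply/negP => cD; have zc : z = c.
    by apply: zuniq; split=> // b /zmin; exact: le_trans.
  by move: ce; rewrite /= zc subrr enorm0 leNgt e0.
exists (Num.min 1 ((enorm (q - c) - D) / 2)).
  by rewrite lt_min ltr01 divr_gt0// subr_gt0.
move=> b Ab qb; apply: (notK _ b _ Ab qb) => [|Kb].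
  by rewrite ge_min lexx.
have := cmin b; rewrite inE => /(_ Kb); rewrite !(enorm_distC _ q) => cb.
have : D + Num.min 1 ((enorm (q - c) - D) / 2) < enorm (q - c).
  by rewrite -ltrBrDl gt_min ltr_pdivrMr// ltr_pMr ?subr_gt0// ltr1n orbT.
by move=> /(le_lt_trans (le_trans cb qb)); rewrite ltxx.
Qed.

(* The points of [A] whose distance to [q + t (q - z)] could be small are, by
   stability of the nearest point, close to [z], so that they are seen from [q]
   almost in the direction of [z]. *)
Lemma edist_growth q z c : closed A -> unique (nearest q) z -> z != q ->
  0 <= c < 1 -> \forall t \near 0^'+,
    (1 + c * t) * enorm (q - z) <= edist (q + t *: (q - z)) A.
Proof.
move=> clA zuniq zq /andP[c0 c1]; set D := enorm (q - z).
have D0 : 0 < D by rewrite enorm_gt0// subr_eq0 eq_sym.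
have [|h h0 near_z] := nearest_stable (e := (1 - c) * D) clA zuniq.
  by rewrite mulr_gt0// subr_gt0.
near=> t; have t0 : 0 < t by near: t; exact: nbhs_right_gt.
have th : t * (2 * D) <= h.
  by near: t; apply: nbhs_right0_mulr_le => //; exact: mulr_gt0.
have tD0 : 0 < t * D by exact: mulr_gt0.
have ctD : 0 <= (t * D) * (1 - c) by rewrite mulr_ge0 ?subr_ge0 // ltW.
apply: le_edist => [|b Ab]; first by exists z; case: zuniq => -[].
have [far|close] := ltP (D + h) (enorm (q - b)).
  have := enorm_distD (q + t *: (q - z)) q b.
  by rewrite opprD addrA subrr add0r enormN enormZ (gtr0_norm t0) -/D; nra.
have cos_ge : c * D ^+ 2 <= edot (q - b) (q - z).
  have -> : q - b = (q - z) - (b - z) by rewrite opprB addrA subrK.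
  rewrite edotDl edotNl -enorm_sqr -/D.
  have := edot_le_enorm (b - z) (q - z); have := near_z b Ab close.
  by rewrite -/D; nra.
have D_le : D ^+ 2 <= enorm (q - b) ^+ 2.
  by rewrite ler_sqr ?nnegrE ?enorm_ge0 ?zuniq.1.2.
rewrite -ler_sqr ?nnegrE ?enorm_ge0//; last first.
  by rewrite mulr_ge0 ?addr_ge0 ?mulr_ge0 ?(ltW t0) ?(ltW D0).
rewrite (addrAC q) enorm_sqrD enormZ (gtr0_norm t0) edotZr -/D.
have : 0 <= (t * D) ^+ 2 * (1 - c ^+ 2).
  by rewrite mulr_ge0 ?sqr_ge0// subr_ge0; nra.
by have := ler_wpM2l (ltW t0) cos_ge; lra.
Unshelve. all: by end_near. Qed.

End Distance.

Section TangentCone.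
Context {R : realType} {d : nat}.
Variable A : set 'rV[R]_d.
Implicit Types (a b u w x z : 'rV[R]_d) (c e h r : R).

Lemma cvg0_le_harmonic (f : nat -> R) c : (forall i, 0 <= f i) ->
  (forall i, f i <= c * i.+1%:R^-1) -> f @ \oo --> (0 : R).
Proof.
move=> f0 fc.
apply: (@squeeze_cvgr _ _ _ _ (fun=> 0) (fun i => c * harmonic i)).
- by near=> i; rewrite f0 fc.
- exact: cvg_cst.
- by rewrite -[X in _ --> X](mulr0 c); apply: cvgMr; exact: cvg_harmonic.
Unshelve. all: by end_near. Qed.

Lemma TanP x u : A x -> Tan A x u <-> forall e, 0 < e -> exists b r,
  [/\ A b, 0 < r, enorm (b - x) < e & enorm (r *: (b - x) - u) < e].
Proof.
move=> Ax; split=> [[->|[xs [r [xsA [cvg_x cvg_u]]]]] e e0|approx].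
- by exists x, 1; rewrite subrr scaler0 subr0 enorm0.
- move/cvgrPdist_lt : cvg_x => /(_ _ e0) near_x.
  move/cvgrPdist_lt : cvg_u => /(_ _ e0) near_u.
  have [i []] := filter_ex (filterI near_x near_u).
  rewrite /= !sub0r !normrN !ger0_norm ?enorm_ge0// => xsi ui.
  by have [Axs [_ r0]] := xsA i; exists (xs i), (r i).
- have [->|u0] := eqVneq u 0; [by left|right].
  have /choice[br brP] (i : nat) : exists br : 'rV[R]_d * R,
      [/\ A br.1, 0 < br.2, enorm (br.1 - x) < Num.min i.+1%:R^-1 (enorm u) &
        enorm (br.2 *: (br.1 - x) - u) < Num.min i.+1%:R^-1 (enorm u)].
    have [|b [r brP]] := approx (Num.min i.+1%:R^-1 (enorm u)).
      by rewrite lt_min invr_gt0 ltr0n enorm_gt0.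
    by exists (b, r).
  exists (fun i => (br i).1), (fun i => (br i).2); split; [move=> i|split].
  + have [Ab r0 _ bu] := brP i; split=> //; split=> //.
    apply: contraTneq bu => ->.
    by rewrite subrr scaler0 sub0r enormN lt_min ltxx andbF.
  + apply: (@cvg0_le_harmonic _ 1) => i; first exact: enorm_ge0.
    by have [_ _ /ltW + _] := brP i; rewrite le_min mul1r => /andP[].
  + apply: (@cvg0_le_harmonic _ 1) => i; first exact: enorm_ge0.
    by have [_ _ _ /ltW] := brP i; rewrite le_min mul1r => /andP[].
Qed.

Lemma Tan_secant a u h : A a -> Tan A a u -> 0 < h ->
  exists b r, [/\ A b, 0 < r & \forall delta \near 0^'+, forall x,
    enorm (x - a) < delta -> enorm (b - x) < h /\ enorm (r *: (b - x) - u) < h].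
Proof.
move=> Aa /(TanP _ Aa) approx h0.
have [|b [r [Ab r0 ba bu]]] := approx (h / 2); first by rewrite divr_gt0.
exists b, r; split=> //; near=> delta => x xa.
have dh : delta * 2 <= h by near: delta; exact: nbhs_right0_mulr_le.
have dr : delta * (2 * r) <= h.
  by near: delta; apply: nbhs_right0_mulr_le => //; exact: mulr_gt0.
split; first by have := enorm_distD a b x; rewrite (enorm_distC a); lra.
have -> : r *: (b - x) - u = (r *: (b - a) - u) + r *: (a - x).
  by rewrite addrAC -scalerDr subrKA.
rewrite (le_lt_trans (enormD _ _))// enormZ (gtr0_norm r0) (enorm_distC a).
by have := ler_wpM2r (ltW r0) (ltW xa); lra.
Unshelve. all: by end_near. Qed.

Lemma Tan_closed_eball x w c (z : nat -> 'rV[R]_d) (r : nat -> R) : A x ->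
  (forall n, [/\ A (z n), 0 < r n & closed_eball w c (r n *: (z n - x))]) ->
  enorm (z n - x) @[n --> \oo] --> (0 : R) ->
  exists2 u, Tan A x u & closed_eball w c u.
Proof.
move=> Ax zr cvg_z; pose v n := r n *: (z n - x).
have [|u [uwc u_cluster]] := @closed_eball_compact _ _ w c (v @ \oo) _.
  by exists 0%N => // n _; have [] := zr n.
exists u => //; apply/TanP => // e e0.
have [||_ [[n zne <-] /= vu]] := u_cluster
    [set v n | n in [set n | enorm (z n - x) < e]] [set y | enorm (y - u) < e].
- by apply: filterS (cvgr_lt _ cvg_z _ e0) => n zne; exists n.
- have /(cvgr_lt (enorm (u - u))) := @enorm_dist_continuous _ _ u u.
  by apply; rewrite subrr enorm0.
by exists (z n), (r n); have [] := zr n.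
Qed.

End TangentCone.

Section Subspaces.
Context {R : realType} {d : nat}.
Implicit Types (S U V : set 'rV[R]_d) (u v : 'rV[R]_d).

Lemma span_scaleD S (c c' : R) u v :
  S u -> S v -> span S (c *: u + c' *: v).
Proof.
move=> Su Sv; exists 2%N, (fun i => if i == 0 then c else c').
exists (fun i => if i == 0 then u else v).
by split=> [i|]; [case: ifP|rewrite !big_ord_recl big_ord0 addr0].
Qed.

Lemma span_row_free S k : subspace_dim (span S) k ->
  exists2 M : 'M[R]_(k, d), row_free M & forall i, S (row i M).
Proof.
move=> [B [rB spanB]].
have /choice[f fP] (i : 'I_k) : exists f : {n & 'I_n -> R * 'rV[R]_d},
    (forall j, S (projT2 f j).2) /\
    row i B = \sum_j (projT2 f j).1 *: (projT2 f j).2.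
  have /spanB[n [c [v [Sv ->]]]] := row_sub i B.
  by exists (existT _ n (fun j => (c j, v j))).
pose n i := projT1 (f i).
pose gen (t : {i & 'I_(n i)}) := (projT2 (f (tag t)) (tagged t)).2.
pose N := \matrix_(t < #|{: {i & 'I_(n i)}}|) gen (enum_val t).
have SN t : S (row t N) by rewrite rowK; exact: (fP _).1.
have NB : (N :=: B)%MS.
  apply/eqmxP/andP; split; apply/row_subP => i.
    apply/spanB; exists 1%N, (fun=> 1), (fun=> row i N); split=> //.
    by rewrite big_ord1 scale1r.
  rewrite (fP i).2; apply: summx_sub => j _; apply: scalemx_sub.
  pose t := Tagged (fun i => 'I_(n i)) j.
  have -> : (projT2 (f i) j).2 = row (enum_rank t) N by rewrite rowK enum_rankK.
  exact: row_sub.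
rewrite -rB -NB; exists (rowsub (maxrankfun N) N); first exact: maxrowsub_free.
by move=> i; rewrite row_rowsub.
Qed.

Lemma subspace_dim_row_free V k (P : 'M[R]_(k, d)) u : subspace_dim V k ->
  row_free P -> (forall i, V (row i P)) -> V u -> exists c, u = c *m P.
Proof.
move=> [B [rB VB]] freeP VP /VB uB; apply/submxP; apply: submx_trans uB _.
have PB : (P <= B)%MS by apply/row_subP => i; exact/VB.
by rewrite -(mxrank_leqif_sup PB) rB (eqP freeP).
Qed.

Lemma subspace_dim_mulmx V k n (P : 'M[R]_(n, d)) c : subspace_dim V k ->
  (forall i, V (row i P)) -> V (c *m P).
Proof.
move=> [B [_ VB]] VP; apply/VB; apply: submx_trans (submxMl _ _) _.
by apply/row_subP => i; exact/VB.
Qed.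

Lemma mx_norm_le_enorm_row m (P : 'M[R]_(m, d)) c : 0 <= c ->
  (forall i, enorm (row i P) <= c) -> `|P| <= c.
Proof.
move=> c0 Pc; apply: mx_norm_le => // i j; apply: le_trans (Pc i).
have := le_mx_norm (row i P) 0 j; rewrite mxE => /le_trans; apply.
exact: norm_le_enorm.
Qed.

Definition one_sided_gap U V : R :=
  sup [set edist u V | u in [set u | U u /\ enorm u = 1]].

Lemma rhoE U V : rho U V = Num.max (one_sided_gap U V) (one_sided_gap V U).
Proof. by []. Qed.

Lemma one_sided_gap_le U V c : 0 <= c ->
  (forall u, U u -> enorm u = 1 -> exists2 v, V v & enorm (u - v) <= c) ->
  one_sided_gap U V <= c.
Proof.
move=> c0 UV; rewrite /one_sided_gap; set E := [set _ | _ in _].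
have [/eqP ->|/set0P E0] := boolP (E == set0); first by rewrite sup0.
apply: ge_sup => // _ [u [Uu u1] <-]; have [v Vv uv] := UV u Uu u1.
exact: le_trans (edist_le u Vv) uv.
Qed.

Lemma rho_self U : rho U U <= 0.
Proof.
rewrite rhoE maxxx; apply: one_sided_gap_le => // u Uu _.
by exists u; rewrite ?subrr ?enorm0.
Qed.

Lemma one_sided_gap_le_bases U V k (P Q : 'M[R]_(k, d)) K : 0 <= K ->
  (forall c : 'rV_k, `|c| <= K * `|c *m P|) ->
  subspace_dim U k -> subspace_dim V k ->
  (forall i, U (row i P)) -> (forall i, V (row i Q)) ->
  one_sided_gap U V <= d%:R * k%:R * K * `|P - Q|.
Proof.
move=> K0 injP dU dV UP VQ; apply: one_sided_gap_le => [|u Uu u1].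
  by rewrite !mulr_ge0.
have freeP : row_free P.
  apply: inj_row_free => c cP0; apply/eqP; rewrite -normr_le0.
  by rewrite (le_trans (injP c))// cP0 normr0 mulr0.
have [c uE] := subspace_dim_row_free dU freeP UP Uu.
exists (c *m Q); first exact: subspace_dim_mulmx dV VQ.
have c_le : `|c| <= K.
  by rewrite (le_trans (injP c))// -uE ler_piMr// -u1 norm_le_enorm.
rewrite uE -mulmxBr (le_trans (enorm_le_norm _))// -!mulrA ler_wpM2l//.
by rewrite (le_trans (mx_normM _ _))// -mulrA ler_wpM2l// ler_wpM2r.
Qed.

Lemma rho_le_near_basis k (M : 'M[R]_(k, d)) : row_free M ->
  exists2 K, 0 <= K & exists2 e, 0 < e & forall U V (P Q : 'M[R]_(k, d)),
    subspace_dim U k -> subspace_dim V k ->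
    (forall i, U (row i P)) -> (forall i, V (row i Q)) ->
    `|P - M| <= e -> `|Q - M| <= e -> rho U V <= K * `|P - Q|.
Proof.
move=> /row_free_near_inj_bound[K K0 [e e0 inj_near]].
exists (d%:R * k%:R * K); first by rewrite !mulr_ge0.
exists e => // U V P Q dU dV UP VQ /inj_near injP /inj_near injQ.
by rewrite rhoE ge_max [in X in _ && X]distrC !one_sided_gap_le_bases.
Qed.

End Subspaces.

Section PositiveReach.
Context {R : realType} {d : nat}.
Variables (A : set 'rV[R]_d) (eps : R).
Hypothesis eps0 : 0 < eps.
Hypothesis reachA :
  forall x, edist x A < eps -> exists z, unique (nearest A x) z.
Implicit Types (x y p q z b : 'rV[R]_d) (c r l T : R).

Lemma reach_closed : closed A.
Proof.
have closed_edist0 : closed [set x | edist x A <= 0].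
  apply: preimage_closed (@closed_le R 0) => x _.
  exact: edist_set_continuous.
move=> x /closureS Ax; have {}Ax : edist x A <= 0.
  apply: closed_edist0; apply: Ax => b Ab /=.
  by rewrite (le_trans (edist_le b Ab))// subrr enorm0.
have [z [zP _]] := reachA (le_lt_trans Ax eps0).
have xz : enorm (x - z) = 0.
  by apply/le_anti; rewrite enorm_ge0 -(edist_nearest zP) Ax.
by have [Az _] := zP; rewrite -(subrK z x) (enorm_eq0 xz) add0r.
Qed.

Lemma reach_edist_increase q c T : 0 < edist q A < eps -> 0 <= c < 1 -> 0 < T ->
  exists q', [/\ 0 < enorm (q' - q), enorm (q' - q) <= T &
    edist q A + c * enorm (q' - q) <= edist q' A].
Proof.
move=> /andP[q0 qeps] c01 T0; have [z zuniq] := reachA qeps.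
have qz := edist_nearest zuniq.1; rewrite qz in q0 *.
have zq : z != q by apply: contraTneq q0 => ->; rewrite subrr enorm0 ltxx.
near (0 : R)^'+ => t; have t0 : 0 < t by near: t; exact: nbhs_right_gt.
exists (q + t *: (q - z)).
have -> : enorm (q + t *: (q - z) - q) = t * enorm (q - z).
  by rewrite addrAC subrr add0r enormZ gtr0_norm.
split; first exact: mulr_gt0.
  by near: t; exact: nbhs_right0_mulr_le.
have -> : enorm (q - z) + c * (t * enorm (q - z)) = (1 + c * t) * enorm (q - z).
  by ring.
by near: t; exact: edist_growth reach_closed zuniq zq c01.
Unshelve. all: by end_near. Qed.

(* Maximise [edist y A - c |y - p|] over the ball: by [reach_edist_increase] the
   maximum is attained on the boundary. *)
Lemma reach_edist_ascent p T c :
  0 < edist p A -> 0 <= T -> edist p A + T < eps -> 0 <= c < 1 ->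
  exists2 q, closed_eball p T q & edist p A + c * T <= edist q A.
Proof.
move=> p0 T0 pT /andP[c0 c1]; pose f y := edist y A - c * enorm (y - p).
have f_cont : continuous f.
  apply: (@enorm_lipschitz_continuous _ _ _ (1 + c)) => x y.
  have := ler_wpM2l c0 (enorm_distD x y p); rewrite (enorm_distC y x).
  by have := edist_lipschitz A x y; rewrite /f; lra.
have [q qT qmax] := closed_eball_max p f_cont T0.
have pq : edist p A + c * enorm (q - p) <= edist q A.
  have := qmax p; rewrite /closed_eball/= /f subrr enorm0 mulr0 subr0.
  by move=> /(_ T0); rewrite lerBrDr.
have [Tq|qT'] := leP T (enorm (q - p)).
  by exists q => //; apply: le_trans pq; rewrite lerD2l ler_wpM2l.
have cq0 : 0 <= c * enorm (q - p) by rewrite mulr_ge0 ?enorm_ge0.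
have q_lip := edist_lipschitz A q p.
have [|||q' [q'q0 q'T q'_ge]] := @reach_edist_increase q ((1 + c) / 2)
  (T - enorm (q - p)); [by lra..|].
have q'p := enorm_distD q q' p.
have /qmax : closed_eball p T q' by rewrite /closed_eball/=; lra.
have : 0 < (1 - c) * enorm (q' - q) by rewrite mulr_gt0 ?subr_gt0.
by have := ler_wpM2l c0 q'p; rewrite /f; lra.
Qed.

Lemma reach_edist_ball_max p T :
  0 < edist p A -> 0 < T -> edist p A + T < eps ->
  exists2 q, closed_eball p T q & edist p A + T <= edist q A.
Proof.
move=> p0 T0 pT.
have [q qT qmax] := closed_eball_max p (@edist_set_continuous _ _ A) (ltW T0).
exists q => //; apply/ler_addgt0Pr => e e0.
pose c := Num.max 0 (1 - e / T).
have [|y yT] := @reach_edist_ascent p T c p0 (ltW T0) pT.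
  by rewrite le_max lexx gt_max ltr01 gtrBl divr_gt0.
have : (1 - e / T) * T <= c * T.
  by rewrite ler_pM2r// le_max lexx orbT.
by rewrite mulrBl divfK ?gt_eqF// => eT yp; have := qmax y yT; lra.
Qed.

(* A point [q] of the ball of radius [r - |p - z|] around [p] with
   [edist q A >= r] gives equality in the triangle inequality for [z], [p], [q],
   hence lies on the ray. *)
Lemma reach_normal_ray p z r :
  nearest A p z -> 0 < enorm (p - z) < r -> r < eps ->
  r <= edist (z + (r / enorm (p - z)) *: (p - z)) A.
Proof.
move=> zP; have pz := edist_nearest zP; set D := enorm (p - z) in pz *.
move=> /andP[D0 Dr] reps.
have [|||q qT qr] := @reach_edist_ball_max p (r - D);
  rewrite ?pz ?subr_gt0 ?subrKC//.
rewrite pz subrKC in qr.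
have rqz : r <= enorm (q - z) by apply: le_trans qr (edist_le q zP.1).
have qp : enorm (q - p) = r - D.
  apply/le_anti; rewrite [_ <= _]qT lerBlDr/=.
  by apply: le_trans rqz (enorm_distD p _ _).
suff -> : z + (r / D) *: (p - z) = q by [].
have : enorm (p - z) *: (q - p) = enorm (q - p) *: (p - z).
  apply: enormD_eq_colinear; rewrite subrKA qp -/D; apply/le_anti.
  by rewrite subrK rqz (le_trans (enorm_distD p _ _))// qp subrK.
rewrite qp -/D => /(congr1 (fun u => D^-1 *: u)).
rewrite !scalerA mulVf ?gt_eqF// scale1r => qpE.
have -> : r / D = D^-1 * (r - D) + 1 by field; rewrite gt_eqF.
by rewrite scalerDl scale1r -qpE subrKA subrKC.
Qed.

Lemma reach_normal_quadratic p z b r :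
  nearest A p z -> enorm (p - z) < r -> r < eps -> A b ->
  2 * r * edot (p - z) (b - z) <= enorm (p - z) * enorm (b - z) ^+ 2.
Proof.
move=> zP zr reps Ab; set D := enorm (p - z) in zr *.
have [pz|pz] := eqVneq p z.
  by rewrite /D pz subrr enorm0 edot0l mul0r mulr0.
have D0 : 0 < D by rewrite enorm_gt0// subr_eq0.
have r0 : 0 < r by exact: lt_trans zr.
have rb : r <= enorm ((r / D) *: (p - z) - (b - z)).
  apply: le_trans (_ : _ <= edist (z + (r / D) *: (p - z)) A) _.
    by apply: reach_normal_ray; rewrite ?D0.
  by rewrite (le_trans (edist_le _ Ab))// opprB addrA (addrC z).
move: rb; rewrite -ler_sqr ?nnegrE ?enorm_ge0 ?(ltW r0)//.
rewrite (enorm_sqrB (_ *: _)) enormZ gtr0_norm ?divr_gt0// -/D edotZl.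
rewrite divfK ?gt_eqF// => rb.
have : 2 * (r / D * edot (p - z) (b - z)) <= enorm (b - z) ^+ 2 by lra.
by move=> /(ler_wpM2l (ltW D0)); congr (_ <= _); field; rewrite gt_eqF.
Qed.

(* Averaging [reach_normal_quadratic] at the two endpoints, the first order
   terms add up to [2 r |p - z|^2], where [z] is nearest to
   [p = x + l (b - x)]. *)
Lemma reach_segment_near x b l :
  A x -> A b -> 0 <= l <= 1 -> enorm (b - x) < eps / 2 ->
  exists2 z, A z & enorm (x + l *: (b - x) - z) <= l * enorm (b - x) ^+ 2 / eps.
Proof.
move=> Ax Ab /andP[l0 l1] bx; have e0 := eps0; set p := x + l *: (b - x).
have px : enorm (p - x) < eps / 2.
  apply: le_lt_trans bx; rewrite /p addrAC subrr add0r enormZ ger0_norm//.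
  by rewrite ler_piMl ?enorm_ge0.
have [|z [zP _]] := reachA (x := p).
  by apply: le_lt_trans (edist_le p Ax) _; lra.
exists z; first exact: zP.1.
have pz2 : enorm (p - z) < eps / 2 by exact: le_lt_trans (zP.2 x Ax) px.
have normal_le a : A a -> 2 * (3 / 4 * eps) * edot (p - z) (a - z) <=
    enorm (p - z) * enorm (a - z) ^+ 2.
  by apply: reach_normal_quadratic => //; lra.
have pz : p - z = (x - z) + l *: (b - x) by rewrite /p addrAC.
have xz : x - z = (p - z) - l *: (b - x) by rewrite pz addrK.
have bz : b - z = (p - z) + (1 - l) *: (b - x).
  by rewrite pz scalerBl scale1r addrACA subrr addr0 addrC subrKA.
set D := enorm (p - z) in pz2 normal_le *; set N := enorm (b - x).
have := normal_le x Ax; rewrite xz edotDr edotNr enorm_sqrB -enorm_sqr !edotZr.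
rewrite enormZ -/D -/N => normal_x.
have := normal_le b Ab; rewrite bz edotDr enorm_sqrD -enorm_sqr !edotZr.
rewrite enormZ -/D -/N => normal_b.
rewrite ?ger0_norm ?subr_ge0// in normal_x normal_b.
have : 2 * (3 / 4 * eps) * D ^+ 2 <= D * (D ^+ 2 + l * (1 - l) * N ^+ 2).
  have := lerD (ler_wpM2l (_ : 0 <= 1 - l) normal_x) (ler_wpM2l l0 normal_b).
  by rewrite subr_ge0 => /(_ l1); lra.
have lN0 : 0 <= l * N ^+ 2 by rewrite mulr_ge0 ?sqr_ge0.
have [->|D0] := eqVneq D 0; first by rewrite divr_ge0// ltW.
have {}D0 : 0 < D by rewrite lt_def D0 enorm_ge0.
rewrite expr2 mulrCA ler_pM2l// ler_pdivlMr// => Dle.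
have : 0 <= l * (l * N ^+ 2) by exact: mulr_ge0.
have : D * D <= D * (eps / 2) by rewrite ler_pM2l// ltW.
by lra.
Qed.

Lemma reach_chord_near_Tan x y : A x -> A y -> enorm (y - x) < eps / 2 ->
  exists2 u, Tan A x u & enorm (u - (y - x)) <= enorm (y - x) ^+ 2 / eps.
Proof.
move=> Ax Ay yx; set w := y - x in yx *; set N := _ / eps.
have /choice[z zP] n : exists z, A z /\
    enorm (x + n.+1%:R^-1 *: w - z) <= n.+1%:R^-1 * enorm w ^+ 2 / eps.
  have n01 : 0 <= (n.+1%:R^-1 : R) <= 1.
    by rewrite invr_ge0 ler0n invf_le1 ?ltr0n// ler1n.
  by have [z Az zn] := reach_segment_near Ax Ay n01 yx; exists z.
have zN n : enorm (n.+1%:R *: (z n - x) - w) <= N.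
  rewrite -[n.+1%:R]invrK enorm_invZB ?invr_gt0// ler_pdivrMr ?invr_gt0//.
  by rewrite mulrC mulrA enorm_distC opprB addrA (addrC _ x) (zP n).2.
apply: (@Tan_closed_eball _ _ A x w N z (fun n => n.+1%:R)) => // [n|].
  by split; [exact: (zP n).1|exact: ltr0Sn|exact: zN].
apply: (@cvg0_le_harmonic _ _ (N + enorm w)) => n; first exact: enorm_ge0.
rewrite ler_pdivlMr// mulrC -[n.+1%:R]gtr0_norm// -enormZ.
have := enorm_distD w (n.+1%:R *: (z n - x)) 0.
by rewrite !subr0; have := zN n; lra.
Qed.

(* Follow the segment from [x] to a point [b] of [A] such that [b - a] is almost
   a multiple of [u]. *)
Lemma reach_Tan_displacement a u e : A a -> Tan A a u -> 0 < e ->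
  exists2 delta, 0 < delta & forall x s, A x -> enorm (x - a) < delta ->
    0 < s < delta -> exists2 z, A z & enorm (z - x - s *: u) <= s * e.
Proof.
move=> Aa Tu e0; pose K := (enorm u + 1) / eps + 1.
have K0 : 0 < K by rewrite ltr_wpDl// divr_ge0 ?addr_ge0 ?enorm_ge0// ltW.
near (0 : R)^'+ => h.
have h0 : 0 < h by near: h; exact: nbhs_right_gt.
have h1 : h <= 1 by near: h; exact: nbhs_right_le.
have heps : h <= eps / 2 by near: h; apply: nbhs_right_le; rewrite divr_gt0.
have he : h * K <= e by near: h; exact: nbhs_right0_mulr_le.
have [b [r [Ab r0 secant]]] := Tan_secant Aa Tu h0.
near (0 : R)^'+ => delta; exists delta => [|x s Ax xa /andP[s0 sd]].
  by near: delta; exact: nbhs_right_gt.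
have [bx bxu] : enorm (b - x) < h /\ enorm (r *: (b - x) - u) < h.
  by move: x xa {Ax}; near: delta.
have rbx : r * enorm (b - x) <= enorm u + 1.
  rewrite -[r in leLHS]gtr0_norm// -enormZ.
  by have := enormD (r *: (b - x) - u) u; rewrite subrK; lra.
have sr1 : 0 <= s * r <= 1.
  have dr : delta * r <= 1 by near: delta; exact: nbhs_right0_mulr_le.
  by rewrite mulr_ge0 ?(ltW s0) ?(ltW r0)//= (le_trans _ dr)// ler_pM2r// ltW.
have [|z Az xz] := reach_segment_near Ax Ab sr1; first by lra.
exists z => //.
have -> : z - x - s *: u =
    - (x + (s * r) *: (b - x) - z) + s *: (r *: (b - x) - u).
  rewrite (scalerBr s) scalerA addrA; congr (_ - _).
  by rewrite opprB opprD addrA subrK.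
rewrite (le_trans (enormD _ _))// enormN enormZ (gtr0_norm s0).
have : s * r * enorm (b - x) ^+ 2 / eps <= s * ((enorm u + 1) * h / eps).
  have -> (n : R) : s * r * n ^+ 2 / eps = s * (r * n * n / eps) by ring.
  rewrite ler_pM2l// ler_pM2r ?invr_gt0//.
  by apply: ler_pM; rewrite ?mulr_ge0 ?enorm_ge0// ltW.
have := ler_wpM2l (ltW s0) (ltW bxu); have := ler_wpM2l (ltW s0) he.
by rewrite /K; lra.
Unshelve. all: by end_near. Qed.

(* Tangent vectors approximate [z - x], [z - y] and [x - y] up to an error of
   order [|x - y|^2], and [z - x = (z - y) - (x - y)]. *)
Lemma reach_Tant_approx_pair x y z u e B : let s := enorm (x - y) in
  A x -> A y -> A z -> x != y -> enorm u <= B -> e <= 1 ->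
  s * (B + 2) < eps / 2 -> enorm (z - x - s *: u) <= s * e ->
  exists v w, [/\ Tant A x v, Tant A y w,
    enorm (v - u) <= s * ((B + 2) ^+ 2 / eps) + e &
    enorm (v - w) <= s * (3 * ((B + 2) ^+ 2 / eps))].
Proof.
move=> s Ax Ay Az xy uB e1 sB zxs; set C := _ ^+ 2 / eps.
have B0 : 0 <= B := le_trans (enorm_ge0 u) uB.
have s0 : 0 < s by rewrite enorm_gt0// subr_eq0.
have Tan_le p q : A p -> A q -> enorm (q - p) <= s * (B + 2) ->
    exists2 g, Tan A p g & enorm (g - (q - p)) <= s * (s * C).
  move=> Ap Aq qp.
  have [|g Tg gle] := reach_chord_near_Tan Ap Aq; first by lra.
  exists g => //; apply: le_trans gle _.
  have -> : s * (s * C) = (s * (B + 2)) ^+ 2 / eps by rewrite /C; ring.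
  by rewrite ler_pM2r ?invr_gt0// -ler_enorm_sqr// mulr_ge0 ?addr_ge0// ltW.
have zx : enorm (z - x) <= s * (B + 1).
  have := enormD (z - x - s *: u) (s *: u); rewrite subrK enormZ (gtr0_norm s0).
  by have := ler_wpM2l (ltW s0) uB; have := ler_wpM2l (ltW s0) e1; lra.
have [|g Tg gz] := Tan_le x z Ax Az; first by lra.
have [|g1 Tg1 g1z] := Tan_le y z Ay Az.
  by have := enorm_distD x z y; rewrite -/s; lra.
have [|g2 Tg2 g2x] := Tan_le y x Ay Ax.
  by rewrite ler_peMr ?(ltW s0)//; lra.
exists (s^-1 *: g), (s^-1 *: (g1 - g2)); split.
- by rewrite -[_ *: g]addr0 -(scale0r g); apply: span_scaleD.
- by rewrite scalerBr -scaleNr; apply: span_scaleD.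
- rewrite enorm_invZB// ler_pdivrMr// mulrC.
  by have := enormD (g - (z - x)) (z - x - s *: u); rewrite subrKA; lra.
- rewrite enorm_invZB// scalerA divff ?gt_eqF// scale1r ler_pdivrMr// mulrC.
  have -> : g - (g1 - g2) = (g - (z - x)) - (g1 - (z - y)) + (g2 - (x - y)).
    by apply/rowP => i; rewrite !mxE; ring.
  have := enormD (g - (z - x) - (g1 - (z - y))) (g2 - (x - y)).
  by have := enormD (g - (z - x)) (- (g1 - (z - y))); rewrite enormN; lra.
Qed.

Lemma reach_Tant_approx_near a u e B :
  A a -> Tan A a u -> enorm u <= B -> 0 < e ->
  \forall delta \near 0^'+, forall x y, A x -> A y -> x != y ->
    enorm (x - a) < delta -> enorm (y - a) < delta ->
    exists v w, [/\ Tant A x v, Tant A y w,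
      enorm (v - u) <= e, enorm (w - u) <= e &
      enorm (v - w) <= enorm (x - y) * (3 * ((B + 2) ^+ 2 / eps))].
Proof.
move=> Aa Tu uB e0; set C := _ ^+ 2 / eps.
have B0 : 0 <= B := le_trans (enorm_ge0 u) uB.
have C0 : 0 < C by rewrite divr_gt0 ?exprn_gt0// ltr_wpDl.
pose e' := Num.min 1 (e / 2).
have e'0 : 0 < e' by rewrite lt_min ltr01 divr_gt0.
have [e'1 e'e] : e' <= 1 /\ e' <= e / 2.
  by split; rewrite ge_min lexx ?orbT.
have [h h0 step] := reach_Tan_displacement Aa Tu e'0.
near=> delta => x y Ax Ay xy xa ya; set s := enorm (x - y).
have s0 : 0 < s by rewrite enorm_gt0 ?subr_eq0.
have sd : s < 2 * delta.
  by have := enorm_distD a x y; rewrite (enorm_distC a) -/s; lra.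
have dh : delta * 2 <= h by near: delta; exact: nbhs_right0_mulr_le.
have dB : delta * (4 * (B + 2)) <= eps.
  by near: delta; apply: nbhs_right0_mulr_le; rewrite // mulr_gt0// ltr_wpDl.
have dC : delta * (16 * C) <= e.
  by near: delta; apply: nbhs_right0_mulr_le => //; exact: mulr_gt0.
have sB : s * (B + 2) < eps / 2.
  have : s * (B + 2) < 2 * delta * (B + 2) by rewrite ltr_pM2r ?ltr_wpDl.
  by lra.
have sC : s * C < 2 * delta * C by rewrite ltr_pM2r.
have [|||z Az zxs] := step x s => //; [lra|by rewrite s0; lra|].
have [v [w [Tv Tw vu vw]]] :=
  reach_Tant_approx_pair Ax Ay Az xy uB e'1 sB zxs.
exists v, w; split=> //; rewrite -/s -/C in vu vw; first by lra.
by have := enorm_distD v w u; rewrite (enorm_distC w v); lra.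
Unshelve. all: by end_near. Qed.

Lemma reach_Tant_bases_near k a (M : 'M[R]_(k, d)) e :
  A a -> (forall i, Tan A a (row i M)) -> 0 < e ->
  exists L, \forall delta \near 0^'+, forall x y,
    A x -> A y -> x != y -> enorm (x - a) < delta -> enorm (y - a) < delta ->
    exists P Q : 'M[R]_(k, d),
      [/\ forall i, Tant A x (row i P), forall i, Tant A y (row i Q),
        `|P - M| <= e, `|Q - M| <= e & `|P - Q| <= L * enorm (x - y)].
Proof.
move=> Aa TM e0; pose B := d%:R * `|M|.
have rowB i : enorm (row i M) <= B.
  by rewrite (le_trans (enorm_le_norm _))// ler_wpM2l// mx_norm_row.
pose L := 3 * ((B + 2) ^+ 2 / eps).
have L0 : 0 <= L by rewrite mulr_ge0// divr_ge0 ?sqr_ge0// ltW.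
exists L => //.
have near_rows i := reach_Tant_approx_near Aa (TM i) (rowB i) e0.
apply: filterS (filter_forall _ near_rows) => delta {}near_rows.
move=> x y Ax Ay xy xa ya.
have /choice[f fP] i := near_rows i x y Ax Ay xy xa ya.
have /choice[g gP] i := fP i.
exists (\matrix_i f i), (\matrix_i g i); split=> [i|i|||].
- by rewrite rowK; case: (gP i).
- by rewrite rowK; case: (gP i).
- apply: (mx_norm_le_enorm_row (ltW e0)) => i.
  by rewrite linearB/= rowK; case: (gP i).
- apply: (mx_norm_le_enorm_row (ltW e0)) => i.
  by rewrite linearB/= rowK; case: (gP i).
- apply: mx_norm_le_enorm_row => [|i]; first by rewrite mulr_ge0 ?enorm_ge0.
  by rewrite linearB/= !rowK mulrC; case: (gP i).
Qed.

End PositiveReach.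

Theorem theorem3p11 (R : realType) (d k : nat) (A : set 'rV[R]_d)
    (a : 'rV[R]_d) :
  (2 <= d)%N -> (1 <= k)%N -> (k <= d - 1)%N ->
  positive_reach A -> T_k A k a ->
  exists delta : R, 0 < delta /\
    psi_lipschitz_on A (T_k A k `&` eball a delta).
Proof.
move=> _ _ _ [eps [eps0 reachA]] [Aa dTa].
have [M freeM TanM] := span_row_free dTa.
have [K K0 [e e0 rho_le]] := rho_le_near_basis freeM.
have [L near_bases] := reach_Tant_bases_near eps0 reachA Aa TanM e0.
have [delta [delta0 bases]] :=
  filter_ex (filterI (nbhs_right_gt 0) near_bases).
exists delta; split=> //; exists (K * L) => x y [[Ax dTx] xa] [[Ay dTy] ya].
have [<-|xy] := eqVneq x y; first by rewrite subrr enorm0 mulr0 rho_self.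
have [P [Q [TP TQ PM QM PQ]]] := bases x y Ax Ay xy xa ya.
apply: le_trans (rho_le _ _ P Q dTx dTy TP TQ PM QM) _.
by rewrite -mulrA ler_wpM2l.
Qed.
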